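(* Let $K$ be a compact Hausdorff space. Then the space $(C(K,\mathbb{E}^1_{\ell}),D)$ can be embedded isomorphically and isometrically onto a closed convex cone of $(\overline{C}([0,1]\times K)\times \overline{C}([0,1]\times K),D_{\infty})$, where $$D_{\infty}((f,g),(h,j)):=\max\{\|f-h\|_{\infty},\|g-j\|_{\infty}\}.$$ That is, there is a map $\Phi: C(K,\mathbb{E}^1_{\ell})\to \overline{C}([0,1]\times K)\times \overline{C}([0,1]\times K)$ such that: $\Phi$ is one-to-one; $\Phi(\mu f+\eta g)=\mu\Phi(f)+\eta\Phi(g)$ for all $f,g\in C(K,\mathbb{E}^1_{\ell})$ and all real $\mu,\eta\ge 0$; $D_\infty(\Phi(f),\Phi(g))=D(f,g)$ for all $f,g\in C(K,\mathbb{E}^1_{\ell})$; and the image $\Phi(C(K,\mathbb{E}^1_{\ell}))$ is a closed subset of $(\overline{C}([0,1]\times K)\times \overline{C}([0,1]\times K),D_{\infty})$ and a convex cone (closed under linear combinations with nonnegative real coefficients, formed pointwise).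
   Context: Fuzzy numbers. For $u:\mathbb{R}\to[0,1]$ and $\lambda\in(0,1]$ put $[u]^{\lambda}:=\{x\in\mathbb{R}: u(x)\ge\lambda\}$, and $[u]^0:=\mathrm{cl}_{\mathbb{R}}\{x\in\mathbb{R}: u(x)>0\}$. The set $\mathbb{E}^1$ of fuzzy numbers consists of all $u:\mathbb{R}\to[0,1]$ such that: (1) $u(x_0)=1$ for some $x_0\in\mathbb{R}$; (2) $u(\lambda x+(1-\lambda)y)\ge\min\{u(x),u(y)\}$ for all $x,y\in\mathbb{R}$, $\lambda\in[0,1]$; (3) $u$ is upper semicontinuous; (4) $[u]^0$ is compact. For $u\in\mathbb{E}^1$ each $[u]^\lambda$, $\lambda\in[0,1]$, is a compact interval, written $[u^-(\lambda),u^+(\lambda)]$. Sums and real scalar multiples of fuzzy numbers are defined by interval arithmetic on levels: $[u+v]^\lambda=[u]^\lambda+[v]^\lambda$ and $[ku]^\lambda=k[u]^\lambda$. Level-convergence topology. $\mathbb{E}^1_{\ell}$ denotes $\mathbb{E}^1$ with the topology whose basic open sets are $$V(u,\{\lambda_1,\dots,\lambda_n\},\epsilon)=\{v\in\mathbb{E}^1: \max_{1\le j\le n}\{|v^-(\lambda_j)-u^-(\lambda_j)|,|v^+(\lambda_j)-u^+(\lambda_j)|\}<\epsilon\},$$ with $u\in\mathbb{E}^1$, $\{\lambda_1,\dots,\lambda_n\}\subset[0,1]$ finite, $\epsilon>0$. $C(K,\mathbb{E}^1_\ell)$ is the set of continuous functions $K\to\mathbb{E}^1_\ell$, with pointwise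 sum and scalar multiplication. For $f\in C(K,\mathbb{E}^1_\ell)$ put $f_1(\lambda,t):=f(t)^-(\lambda)$ and $f_2(\lambda,t):=f(t)^+(\lambda)$ for $(\lambda,t)\in[0,1]\times K$. The metric $D$ on $C(K,\mathbb{E}^1_\ell)$ is $$D(f,g):=\sup_{t\in K}\sup_{\lambda\in[0,1]}\max\{|f_1(\lambda,t)-g_1(\lambda,t)|,|f_2(\lambda,t)-g_2(\lambda,t)|\}.$$ The space $\overline{C}([0,1]\times K)$. It is the set of functions $f:[0,1]\times K\to\mathbb{R}$ such that: (i) $f$ is jointly left continuous - continuous at each $(\lambda_0,t_0)\in(0,1]\times K$, i.e. for every $\epsilon>0$ there exist $\delta>0$ and an open neighbourhood $V$ of $t_0$ with $|f(\alpha,s)-f(\lambda_0,t_0)|<\epsilon$ for all $\alpha\in(\lambda_0-\delta,\lambda_0)\cap[0,1]$, $s\in V$; (ii) $f$ is jointly right continuous - continuous at each $(0,t_0)$, $t_0\in K$, i.e. for every $\epsilon>0$ there exist $\delta>0$ and an open neighbourhood $V$ of $t_0$ with $|f(\alpha,s)-f(0,t_0)|<\epsilon$ for all $\alpha\in(0,\delta)\cap[0,1]$, $s\in V$; (iii) for every $t\in K$, $f(\cdot,t)$ is monotone on $[0,1]$ (nondecreasing or nonincreasing, possibly depending on $t$). All functions in $\overline{C}([0,1]\times K)$ are bounded, and $\|f\|_\infty:=\sup_{[0,1]\times K}|f|$. The set $\overline{C}([0,1]\times K)$ is not closed under sums; linear combinations of pairs are taken pointwise (in the space of pairs of bounded functions).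 ''Isomorphically'' refers to preservation of sums and multiplication by nonnegative scalars. *)

(* Defs.v *)
From HB Require Import structures.
From mathcomp Require Import all_boot all_order all_algebra.
From mathcomp Require Import ring lra.
From mathcomp Require Import all_classical all_reals all_analysis.

Set Implicit Arguments.
Unset Strict Implicit.
Unset Printing Implicit Defensive.

Import Order.TTheory GRing.Theory Num.Theory.
Import numFieldNormedType.Exports.

Local Open Scope classical_set_scope.
Local Open Scope ring_scope.

Definition upper_semicontinuous (R : realType) (u : R -> R) :=
  forall x c, u x < c -> \forall y \near x, u y < c.

Definition zero01 (R : realType) : {i01 R} := 0%:i01.

Definition level (R : realType) (u : R -> R) (l : {i01 R}) : set R :=
  if l%:num == 0 then closure [set x | 0 < u x] else [set x | l%:num <= u x].

Record fuzzy (R : realType) := Fuzzy {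
  fuzzy_fun :> R -> R ;
  fuzzy_range : forall x, 0 <= fuzzy_fun x <= 1 ;
  fuzzy_normal : exists x0, fuzzy_fun x0 = 1 ;
  fuzzy_convex : forall (l : {i01 R}) x y,
    Num.min (fuzzy_fun x) (fuzzy_fun y) <=
    fuzzy_fun (l%:num * x + (1 - l%:num) * y) ;
  fuzzy_usc : upper_semicontinuous fuzzy_fun ;
  fuzzy_compact : compact (level fuzzy_fun (zero01 R)) }.

HB.instance Definition _ (R : realType) := gen_eqMixin (fuzzy R).
HB.instance Definition _ (R : realType) := gen_choiceMixin (fuzzy R).

(* [level u l] is a compact interval (lemma [level_itv]), so these are its
   endpoints. *)
Definition fminus (R : realType) (u : fuzzy R) (l : {i01 R}) : R :=
  inf (level u l).
Definition fplus (R : realType) (u : fuzzy R) (l : {i01 R}) : R :=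
  sup (level u l).

Section fuzzy_levels.
Context {R : realType}.
Implicit Types (u v w : fuzzy R) (l m : {i01 R}).

Lemma i01_ge0 l : 0 <= l%:num. Proof. by []. Qed.
Lemma i01_le1 l : l%:num <= 1. Proof. by []. Qed.

Lemma i01_gt0 l : (l%:num == 0) = ~~ (0 < l%:num).
Proof. by rewrite lt_neqAle i01_ge0 andbT negbK eq_sym. Qed.

Lemma i01_eq0 l : l%:num <= 0 -> l = zero01 R.
Proof. by move=> l0; apply/val_inj/eqP; rewrite /= eq_le l0 i01_ge0. Qed.

Lemma level0 (u : R -> R) : level u (zero01 R) = closure [set x | 0 < u x].
Proof. by rewrite /level eqxx. Qed.

Lemma level_gt0 (u : R -> R) l :
  0 < l%:num -> level u l = [set x | l%:num <= u x].
Proof. by move=> l0; rewrite /level i01_gt0 l0. Qed.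

Lemma level_sub0 u l : level u l `<=` level u (zero01 R).
Proof.
have [l0|l0] := ltP 0 l%:num.
  rewrite level_gt0// => x /= lx; rewrite level0.
  by apply: subset_closure => /=; exact: lt_le_trans lx.
rewrite (i01_eq0 l0).
by [].
Qed.

Lemma level_le u l m : (l <= m)%O -> level u m `<=` level u l.
Proof.
move=> lm; have lm' : l%:num <= m%:num by [].
have [l0|l0] := ltP 0 l%:num.
  rewrite !level_gt0 ?(lt_le_trans l0)// => x /=; exact: le_trans.
rewrite (i01_eq0 l0).
exact: level_sub0.
Qed.

Lemma level_neq0 u l : level u l !=set0.
Proof.
have [x ux] := fuzzy_normal u; exists x; apply: (@level_le _ _ 1%:i01).
  exact: i01_le1.
by rewrite level_gt0/= ?ux.
Qed.

Lemma usc_ge_closed u (c : R) : closed [set x | c <= u x].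
Proof.
rewrite -openC openE => x /= /negP; rewrite -ltNge => /fuzzy_usc.
by apply: filterS => y uyc; apply/negP; rewrite -ltNge.
Qed.

Lemma convex_is_interval u (P : set R) :
  (forall x y z, P x -> P y -> Num.min (u x) (u y) <= u z -> P z) ->
  is_interval P.
Proof.
move=> h x y Px Py z /andP[xz zy]; apply: (h x y) => //.
have [xy|xy] := eqVneq x y.
  have -> : z = x by apply/eqP; rewrite eq_le xz andbT xy.
  by rewrite ge_min lexx.
have yx0 : 0 < y - x by rewrite subr_gt0 lt_neqAle xy/= (le_trans xz).
have t0 : 0 <= (y - z) / (y - x) by rewrite divr_ge0 ?subr_ge0// ltW// -subr_gt0.
have t1 : (y - z) / (y - x) <= 1 by rewrite ler_pdivrMr// mul1r lerB.
have := fuzzy_convex u (Itv01 t0 t1) x y => /=.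
by rewrite (_ : _ * x + _ = z)//; field; rewrite gt_eqF.
Qed.

Lemma level_interval u l : is_interval (level u l).
Proof.
have [l0|l0] := ltP 0 l%:num.
  rewrite level_gt0//; apply: (@convex_is_interval u) => x y z /= lx ly.
  by apply: le_trans; rewrite le_min lx.
rewrite /level i01_gt0 -leNgt l0.
apply/connected_intervalP/connected_closure/connected_intervalP.
apply: (@convex_is_interval u) => x y z /= lx ly.
by apply: lt_le_trans; rewrite lt_min lx.
Qed.

Lemma level_closed u l : closed (level u l).
Proof.
have [l0|l0] := ltP 0 l%:num; first by rewrite level_gt0//; exact: usc_ge_closed.
by rewrite /level i01_gt0 -leNgt l0; exact: closed_closure.
Qed.

Lemma level_compact u l : compact (level u l).
Proof.
exact: (subclosed_compact (@level_closed u l) (@fuzzy_compact _ u)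
  (@level_sub0 u l)).
Qed.

Lemma level_has_sup u l : has_sup (level u l).
Proof.
split; first exact: level_neq0.
have [M [_ /(_ (M + 1))]] := compact_bounded (@level_compact u l).
rewrite ltrDl => /(_ ltr01) h; exists (M + 1) => x /h.
exact/le_trans/ler_norm.
Qed.

Lemma level_has_inf u l : has_inf (level u l).
Proof.
split; first exact: level_neq0.
have [M [_ /(_ (M + 1))]] := compact_bounded (@level_compact u l).
rewrite ltrDl => /(_ ltr01) h; exists (- (M + 1)) => x /h /=.
by rewrite ler_norml => /andP[].
Qed.

Lemma fminus_level u l : level u l (fminus u l).
Proof.
apply: level_closed; move=> B /nbhs_ballP[e /= e0 eB].
have [x ux xe] := inf_adherent e0 (level_has_inf u l); exists x; split => //.
have : fminus u l <= x by apply: ge_inf => //; exact: (level_has_inf u l).2.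
by move=> h; apply: eB; rewrite /ball/= /fminus ltr_norml;
  apply/andP; split; rewrite /fminus in h *; lra.
Qed.

Lemma fplus_level u l : level u l (fplus u l).
Proof.
apply: level_closed; apply: closure_sup; first exact: (level_has_sup u l).1.
exact: (level_has_sup u l).2.
Qed.

Lemma level_itv u l : level u l = `[fminus u l, fplus u l]%classic.
Proof.
apply/seteqP; split => x /=; rewrite in_itv/=.
  by move=> ux; rewrite (ge_inf (level_has_inf u l).2)// (ub_le_sup (level_has_sup u l).2).
exact/level_interval/fplus_level/fminus_level.
Qed.

Lemma fminus_le_fplus u l : fminus u l <= fplus u l.
Proof. by have := fminus_level u l; rewrite {1}level_itv/= in_itv/= => /andP[]. Qed.

Lemma fminus_homo u l m : (l <= m)%O -> fminus u l <= fminus u m.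
Proof.
move=> lm; apply: ge_inf; first exact: (level_has_inf u l).2.
exact/(level_le lm)/fminus_level.
Qed.

Lemma fplus_homo u l m : (l <= m)%O -> fplus u m <= fplus u l.
Proof.
move=> lm; apply: ub_le_sup; first exact: (level_has_sup u l).2.
exact/(level_le lm)/fplus_level.
Qed.

Definition lr_continuous (a : {i01 R} -> R) :=
  (forall l, 0 < l%:num -> forall e, 0 < e -> exists2 d, 0 < d &
    forall m, l%:num - d < m%:num < l%:num -> `|a m - a l| < e) /\
  (forall e, 0 < e -> exists2 d, 0 < d &
    forall m, 0 < m%:num < d -> `|a m - a (zero01 R)| < e).

Let level_lim u l x : 0 < l%:num ->
  (forall m, (m < l)%O -> level u m x) -> level u l x.
Proof.
move=> l0 h; rewrite level_gt0//=; apply/ler_addgt0Pr => e e0.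
pose d := Num.min e (l%:num / 2).
have d0 : 0 < d by rewrite lt_min e0 divr_gt0.
have dl : d <= l%:num / 2 by rewrite ge_min lexx orbT.
have de : d <= e by rewrite ge_min lexx.
have l1 := i01_le1 l.
have m0 : 0 <= l%:num - d by lra.
have m1 : l%:num - d <= 1 by lra.
have := h (Itv01 m0 m1); rewrite level_gt0/=; last by lra.
move=> h'; have {h'} : l%:num - d <= u x.
  by apply: h'; change (l%:num - d < l%:num); lra.
by move=> ?; lra.
Qed.

Lemma fminus_lr u : lr_continuous (fminus u).
Proof.
split=> [l l0 e e0|e e0].
  apply: contrapT => H.
  suff : level u l (fminus u l - e).
    rewrite level_itv/= in_itv/= => /andP[+ _]; lra.
  apply: level_lim => // m ml; rewrite level_itv/= in_itv/=.
  have mple : fplus u l <= fplus u m by apply: fplus_homo; exact: ltW.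
  have := fminus_le_fplus u l => le; apply/andP; split; last by lra.
  rewrite leNgt; apply/negP => hm; apply: H.
  have ml' : m%:num < l%:num by [].
  exists (l%:num - m%:num); first by rewrite subr_gt0.
  move=> k /andP[mk kl].
  have : fminus u m <= fminus u k.
    by apply: fminus_homo; change (m%:num <= k%:num); lra.
  have : fminus u k <= fminus u l by apply: fminus_homo; exact: ltW.
  rewrite ltr_norml => ? ?; apply/andP; split; lra.
have := fminus_level u (zero01 R); rewrite level0.
move=> /(_ _ (nbhsx_ballx _ _ e0)) [y [/= uy0]].
rewrite /ball/= ltr_norml => /andP[h1 h2]; exists (u y) => //= m /andP[m0 mu].
have ym : level u m y by rewrite level_gt0//=; exact: ltW.
have : fminus u m <= y by apply: ge_inf => //; exact: (level_has_inf u m).2.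
have : fminus u (zero01 R) <= fminus u m by apply: fminus_homo; exact: i01_ge0.
rewrite ltr_norml => ? ?; apply/andP; split; lra.
Qed.

Lemma fplus_lr u : lr_continuous (fplus u).
Proof.
split=> [l l0 e e0|e e0].
  apply: contrapT => H.
  suff : level u l (fplus u l + e).
    rewrite level_itv/= in_itv/= => /andP[_]; lra.
  apply: level_lim => // m ml; rewrite level_itv/= in_itv/=.
  have mple : fminus u m <= fminus u l by apply: fminus_homo; exact: ltW.
  have := fminus_le_fplus u l => le; apply/andP; split; first by lra.
  rewrite leNgt; apply/negP => hm; apply: H.
  have ml' : m%:num < l%:num by [].
  exists (l%:num - m%:num); first by rewrite subr_gt0.
  move=> k /andP[mk kl].
  have : fplus u k <= fplus u m.
    by apply: fplus_homo; change (m%:num <= k%:num); lra.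
  have : fplus u l <= fplus u k by apply: fplus_homo; exact: ltW.
  rewrite ltr_norml => ? ?; apply/andP; split; lra.
have := fplus_level u (zero01 R); rewrite level0.
move=> /(_ _ (nbhsx_ballx _ _ e0)) [y [/= uy0]].
rewrite /ball/= ltr_norml => /andP[h1 h2]; exists (u y) => //= m /andP[m0 mu].
have ym : level u m y by rewrite level_gt0//=; exact: ltW.
have : y <= fplus u m by apply: ub_le_sup => //; exact: (level_has_sup u m).2.
have : fplus u m <= fplus u (zero01 R) by apply: fplus_homo; exact: i01_ge0.
rewrite ltr_norml => ? ?; apply/andP; split; lra.
Qed.

(* Goetschel-Voxman: existence of a fuzzy number with prescribed levels. *)
Section of_endpoints.
Variables (a b : {i01 R} -> R).
Hypotheses (ab : forall l, a l <= b l)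
  (a_homo : forall l m, (l <= m)%O -> a l <= a m)
  (b_homo : forall l m, (l <= m)%O -> b m <= b l)
  (a_lr : lr_continuous a) (b_lr : lr_continuous b).

Let S x := [set l%:num | l in [set l : {i01 R} | a l <= x <= b l]].
Let u x := sup (S x).

Let S_ub x : has_ubound (S x).
Proof. by exists 1 => _ [l _ <-]. Qed.

Let u_in x l : a l <= x <= b l -> l%:num <= u x.
Proof. by move=> h; apply: ub_le_sup => //; exists l. Qed.

Let u_ge x l : 0 < l%:num -> l%:num <= u x -> a l <= x <= b l.
Proof.
move=> l0 lu; have near_l d : 0 < d -> exists2 m : {i01 R},
    l%:num - d < m%:num & a m <= x <= b m.
  move=> d0; have : l%:num - d < u x by lra.
  have S0 : S x !=set0.
    apply/set0P/negP => /eqP S0; move: lu; rewrite /u S0 sup0; lra.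
  by move=> /(sup_gt S0)[_ [m mx <-]] ?; exists m.
have [al ar] := a_lr; have [bl br] := b_lr.
have key (c : {i01 R} -> R) e : 0 < e ->
    (exists2 d, 0 < d &
    forall m, l%:num - d < m%:num < l%:num -> `|c m - c l| < e) ->
    exists m, [/\ a m <= x <= b m & (l <= m)%O \/ `|c m - c l| < e].
  move=> e0 [d d0 dP]; have [m lm mx] := near_l d d0; exists m; split => //.
  have [?|ml] := leP l m; [by left|right; apply: dP; rewrite lm; exact: ml].
apply/andP; split; apply/ler_addgt0Pr => e e0.
  have [m [/andP[am _] [/a_homo|]]] := key _ _ e0 (al _ l0 _ e0); first by lra.
  rewrite ltr_norml => /andP[]; lra.
have [m [/andP[_ bm] [/b_homo|]]] := key _ _ e0 (bl _ l0 _ e0); first by lra.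
rewrite ltr_norml => /andP[]; lra.
Qed.

Let u01 x : 0 <= u x <= 1.
Proof.
have [S0|/set0P S0] := eqVneq (S x) set0; first by rewrite /u S0 sup0 lexx ler01.
apply/andP; split; last by apply: ge_sup => // _ [l _ <-].
by case: S0 => _ [l lx _]; exact: le_trans (u_in lx).
Qed.

Let u_level l : 0 < l%:num -> [set x | l%:num <= u x] = `[a l, b l]%classic.
Proof.
move=> l0; apply/seteqP; split => x /=; rewrite in_itv/=.
  exact: u_ge.
exact: u_in.
Qed.

Let u_normal : exists x0, u x0 = 1.
Proof.
exists (a 1%:i01); apply/eqP; rewrite eq_le; have [_ ->] := andP (u01 (a 1%:i01)).
by apply: (@u_in _ 1%:i01); rewrite lexx ab.
Qed.

Let u_convex (l : {i01 R}) x y :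
  Num.min (u x) (u y) <= u (l%:num * x + (1 - l%:num) * y).
Proof.
have /andP[m0 m1] : 0 <= Num.min (u x) (u y) <= 1.
  have /andP[x0 x1] := u01 x; have /andP[y0 y1] := u01 y.
  by rewrite le_min x0 y0 ge_min x1.
set m := Num.min _ _ in m0 m1 *.
have [->|mn0] := eqVneq m 0; first by have [] := andP (u01 (l%:num * x + (1 - l%:num) * y)).
have mgt0 : 0 < (Itv01 m0 m1)%:num by rewrite /= lt_neqAle eq_sym mn0.
have /andP[ax bx] : a (Itv01 m0 m1) <= x <= b (Itv01 m0 m1).
  by apply: u_ge => //=; rewrite ge_min lexx.
have /andP[ay By] : a (Itv01 m0 m1) <= y <= b (Itv01 m0 m1).
  by apply: u_ge => //=; rewrite ge_min lexx orbT.
apply: (@u_in _ (Itv01 m0 m1)).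
have l0 := i01_ge0 l; have l1 := i01_le1 l; apply/andP; split; nra.
Qed.

Let u_usc : upper_semicontinuous u.
Proof.
move=> x c uxc; have /andP[ux0 ux1] := u01 x.
have [c1|c1] := ltP 1 c.
  by near=> y; have /andP[_ ?] := u01 y; lra.
have c0 : 0 <= c by lra.
have cc : closed [set y | c <= u y].
  have cgt0 : 0 < (Itv01 c0 c1)%:num by apply: le_lt_trans uxc.
  by have /= -> := u_level cgt0; exact: itv_closed.
rewrite -openC in cc.
have : nbhs x (~` [set y | c <= u y]).
  by apply: open_nbhs_nbhs; split => //=; apply/negP; rewrite -ltNge.
by apply: filterS => y /= /negP; rewrite -ltNge.
Unshelve. all: by end_near. Qed.

Let u_level0 : level u (zero01 R) = `[a (zero01 R), b (zero01 R)]%classic.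
Proof.
rewrite level0; apply/seteqP; split.
  rewrite (closure_id `[a (zero01 R), b (zero01 R)]%classic).1; last exact: itv_closed.
  apply: closure_subset => x /= ux0; have /andP[_ ux1] := u01 x.
  have := @u_ge x (Itv01 (ltW ux0) ux1) ux0 (lexx _) => /andP[ax bx].
  rewrite in_itv/= (le_trans _ ax) ?(le_trans bx)//.
    by apply: b_homo; exact: i01_ge0.
  by apply: a_homo; exact: i01_ge0.
move=> x /=; rewrite in_itv/= => /andP[ax bx] B /nbhs_ballP[e /= e0 eB].
have [da da0 daP] := a_lr.2 _ e0; have [db db0 dbP] := b_lr.2 _ e0.
pose d := Num.min 1 (Num.min da db / 2).
have dd0 : 0 < Num.min da db by rewrite lt_min da0.
have d0 : 0 < d by rewrite lt_min ltr01 divr_gt0.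
have d1 : d <= 1 by rewrite ge_min lexx.
have : d <= Num.min da db / 2 by rewrite ge_min lexx orbT.
have : Num.min da db <= da by rewrite ge_min lexx.
have : Num.min da db <= db by rewrite ge_min lexx orbT.
move=> mb ma md; pose m := Itv01 (ltW d0) d1.
have := daP m; have := dbP m => /=; rewrite d0/=.
move=> /(_ ltac:(lra)) + /(_ ltac:(lra)).
rewrite !ltr_norml => /andP[b1 b2] /andP[a1 a2].
have abm := ab m.
exists (Num.max (a m) (Num.min x (b m))); split => /=.
  apply: (@lt_le_trans _ _ m%:num) => //; apply: u_in.
  by rewrite le_max lexx/= ge_max abm ge_min lexx orbT.
apply: eB; rewrite /ball/= ltr_norml.
by rewrite maxEle minEle; case: ifPn => h1; [|move: h1]; case: ifPn => h2;
  rewrite -?ltNge => *; apply/andP; split; lra.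
Qed.

Lemma fuzzy_of_endpoints :
  exists w : fuzzy R, forall l, level w l = `[a l, b l]%classic.
Proof.
have cpt : compact (level u (zero01 R)) by rewrite u_level0; exact: segment_compact.
exists (Fuzzy u01 u_normal u_convex u_usc cpt) => l /=.
have [l0|l0] := ltP 0 l%:num; first by rewrite level_gt0// u_level.
rewrite (i01_eq0 l0).
exact: u_level0.
Qed.

End of_endpoints.

End fuzzy_levels.

Definition level_basic (R : realType) (u : fuzzy R) (L : seq {i01 R}) (e : R) :
    set (fuzzy R) :=
  [set v | \big[Num.max/0]_(l <- L)
    Num.max `|fminus v l - fminus u l| `|fplus v l - fplus u l| < e].

Section level_topology.
Context {R : realType}.
Implicit Types (u v w : fuzzy R) (L : seq {i01 R}).

Lemma level_basicP u L e v : 0 < e -> level_basic u L e v <->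
  forall l, l \in L ->
    `|fminus v l - fminus u l| < e /\ `|fplus v l - fplus u l| < e.
Proof.
move=> e0; rewrite /level_basic/=; elim: L => [|k L IH].
  by rewrite big_nil; split.
rewrite big_cons gt_max gt_max; split.
  move=> /andP[/andP[h1 h2] /IH h] l; rewrite in_cons => /predU1P[->//|].
  exact: h.
move=> h; have [-> ->] := h k (mem_head _ _); apply/IH => l lL.
by apply: h; rewrite in_cons lL orbT.
Qed.

Lemma level_basic_center u L e : 0 < e -> level_basic u L e u.
Proof. by move=> e0; apply/level_basicP => // l _; rewrite !subrr normr0. Qed.

Definition level_base : set (set (fuzzy R)) :=
  [set B | exists u L e, 0 < e /\ B = level_basic u L e].

Lemma level_base_shrink u L e v : 0 < e -> level_basic u L e v ->
  exists2 d, 0 < d & level_basic v L d `<=` level_basic u L e.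
Proof.
move=> e0 uv; rewrite /level_basic/= in uv; set m := \big[_/_]_(_ <- _) _ in uv.
exists (e - m); first by rewrite subr_gt0.
have mP l : l \in L ->
    `|fminus v l - fminus u l| <= m /\ `|fplus v l - fplus u l| <= m.
  rewrite /m; elim: (L) => // k s IH.
  rewrite in_cons big_cons => /predU1P[->|/IH[h1 h2]].
    by rewrite !le_max !lexx/= orbT.
  by rewrite 2!(@le_max _ _ _ (Num.max _ _)) h1 h2 !orbT.
move=> w /level_basicP; rewrite subr_gt0 => /(_ uv) h.
apply/level_basicP => // l lL; have [h1 h2] := h l lL; have [m1 m2] := mP l lL.
split.
  rewrite (_ : _ - _ = (fminus w l - fminus v l) + (fminus v l - fminus u l)).
    by rewrite (le_lt_trans (ler_normD _ _))//; lra.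
  by lra.
rewrite (_ : _ - _ = (fplus w l - fplus v l) + (fplus v l - fplus u l)).
  by rewrite (le_lt_trans (ler_normD _ _))//; lra.
by lra.
Qed.

Lemma level_base_cover : \bigcup_(B in level_base) B = setT.
Proof.
apply/seteqP; split => // u _; exists (level_basic u [::] 1).
  by exists u, [::], 1.
exact: level_basic_center.
Qed.

Lemma level_base_join (A B : set (fuzzy R)) u :
  level_base A -> level_base B -> A u -> B u ->
  exists C, [/\ level_base C, C u & C `<=` A `&` B].
Proof.
move=> [a [L [e [e0 ->]]]] [b [M [d [d0 ->]]]] au bu.
have [e' e'0 sA] := level_base_shrink e0 au.
have [d' d'0 sB] := level_base_shrink d0 bu.
have m0 : 0 < Num.min e' d' by rewrite lt_min e'0.
exists (level_basic u (L ++ M) (Num.min e' d')); split.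
- by exists u, (L ++ M), (Num.min e' d').
- exact: level_basic_center.
- move=> w /level_basicP => /(_ m0) h; split.
    apply: sA; apply/level_basicP => // l lL.
    by have := h l; rewrite mem_cat lL !lt_min => /(_ isT)[/andP[-> _] /andP[-> _]].
  apply: sB; apply/level_basicP => // l lL.
  by have := h l; rewrite mem_cat lL orbT !lt_min =>
    /(_ isT)[/andP[_ ->] /andP[_ ->]].
Qed.

End level_topology.

(* The level-convergence topology is the default topology on fuzzy numbers. *)
HB.instance Definition _ (R : realType) := isBaseTopological.Build (fuzzy R)
  (@level_base_cover R) (@level_base_join R).

Section level_topology_theory.
Context {R : realType}.

Lemma nbhs_fuzzyP (u : fuzzy R) (A : set (fuzzy R)) :
  nbhs u A <-> exists L, exists2 e, 0 < e & level_basic u L e `<=` A.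
Proof.
rewrite nbhsE; split.
  move=> [B [[D' sD <-] [C D'C Cu]] BA].
  have [v [L [e [e0 CE]]]] := sD _ D'C; rewrite CE in Cu.
  have [d d0 dC] := level_base_shrink e0 Cu.
  by exists L, d => // w /dC Cw; apply: BA; exists C => //; rewrite CE.
move=> [L [e e0 sA]]; exists (level_basic u L e) => //; split.
  exists [set level_basic u L e]; last by rewrite bigcup_set1.
  by move=> _ ->; exists u, L, e.
exact: level_basic_center.
Qed.

Lemma continuous_fuzzyP (T : topologicalType) (f : T -> fuzzy R) :
  continuous f <-> forall l,
    continuous (fun t => fminus (f t) l) /\ continuous (fun t => fplus (f t) l).
Proof.
split=> [fc l|fc t A /nbhs_fuzzyP[L [e e0 sA]]].
  have H e t : 0 < e -> \forall s \near t,
    `|fminus (f s) l - fminus (f t) l| < e /\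
    `|fplus (f s) l - fplus (f t) l| < e.
    move=> e0; have : nbhs (f t) (level_basic (f t) [:: l] e).
      by apply/nbhs_fuzzyP; exists [:: l], e.
    move=> /fc ft; have : nbhs t (f @^-1` level_basic (f t) [:: l] e) by exact: ft.
    apply: filterS => s /level_basicP => /(_ e0).
    by apply; rewrite mem_head.
  split=> t; apply/cvgrPdist_lt => e e0; have := H e t e0;
    by apply: filterS => s []; rewrite distrC [`|fplus _ _ - _|]distrC.
change (nbhs t (f @^-1` A)).
have : nbhs t (f @^-1` level_basic (f t) L e); last by apply: filterS => s /sA.
suff : \forall s \near t, forall l, l \in L ->
    `|fminus (f s) l - fminus (f t) l| < e /\
    `|fplus (f s) l - fplus (f t) l| < e.
  by apply: filterS => s h; apply/level_basicP.
elim: L {sA} => [|k L IH]; first by near=> s.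
have [/(_ t)/cvgrPdist_lt/(_ e e0) h1 /(_ t)/cvgrPdist_lt/(_ e e0) h2] := fc k.
near=> s => l; rewrite in_cons => /predU1P[->|lL].
  by split; rewrite distrC; [near: s|near: s].
by move: l lL; near: s.
Unshelve. all: by end_near. Qed.

End level_topology_theory.

Section arithmetic.
Context {R : realType}.
Implicit Types (u v w : fuzzy R) (l : {i01 R}) (k : R).

Let itv_inj (a b c d : R) : a <= b -> c <= d ->
  `[a, b]%classic = `[c, d]%classic -> a = c /\ b = d.
Proof.
move=> ab cd E; have Ec x : (a <= x <= b) = (c <= x <= d).
  have : `[a, b]%classic x = `[c, d]%classic x by rewrite E.
  by rewrite /= !in_itv/= => h; apply/idP/idP => ?; [rewrite -h|rewrite h].
have := Ec a; have := Ec b; have := Ec c; have := Ec d.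
rewrite !lexx ab cd !andbT/= => /andP[? ?] /andP[? ?] /esym/andP[? ?] /esym/andP[? ?].
by split; apply/eqP; rewrite eq_le; apply/andP; split.
Qed.

Lemma itv_add (a b c d : R) : a <= b -> c <= d ->
  [set x + y | x in `[a, b] & y in `[c, d]] = `[a + c, b + d]%classic.
Proof.
move=> ab cd; apply/seteqP; split => z /=.
  move=> [x + [y + <-]]; rewrite !in_itv/= => /andP[? ?] /andP[? ?].
  by apply/andP; split; lra.
rewrite in_itv/= => /andP[z1 z2]; have [zb|zb] := leP z (b + c).
  by exists (z - c); [|exists c]; rewrite ?in_itv/= ?subrK//;
    apply/andP; split; lra.
exists b; [|exists (z - b)]; rewrite ?in_itv/=; last by rewrite addrC subrK.
  by apply/andP; split; lra.
by apply/andP; split; lra.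
Qed.

Lemma itv_scale_ge0 k (a b : R) : 0 <= k -> a <= b ->
  [set k * x | x in `[a, b]] = `[k * a, k * b]%classic.
Proof.
move=> k0 ab; apply/seteqP; split => z /=.
  by move=> [x + <-]; rewrite !in_itv/= => /andP[x1 x2]; rewrite !ler_wpM2l.
rewrite in_itv/=; have [->|kn0] := eqVneq k 0.
  rewrite !mul0r -eq_le => /eqP <-; exists a; rewrite ?mul0r//.
  by rewrite in_itv/= lexx.
have {}k0 : 0 < k by rewrite lt_neqAle eq_sym kn0.
move=> /andP[z1 z2]; exists (z / k); last by rewrite mulrC divfK ?gt_eqF.
by rewrite in_itv/= ler_pdivlMr// ler_pdivrMr// ![_ * k]mulrC z1.
Qed.

Lemma itv_scale_lt0 k (a b : R) : k < 0 -> a <= b ->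
  [set k * x | x in `[a, b]] = `[k * b, k * a]%classic.
Proof.
move=> k0 ab; have k0' := ltW k0; apply/seteqP; split => z /=.
  by move=> [x + <-]; rewrite !in_itv/= => /andP[x1 x2]; rewrite !ler_wnM2l.
rewrite in_itv/= => /andP[z1 z2].
exists (z / k); last by rewrite mulrC divfK ?lt_eqF.
by rewrite in_itv/= ler_ndivlMr// ler_ndivrMr// ![_ * k]mulrC z1 z2.
Qed.

Lemma level_endpoints u l a b :
  a <= b -> level u l = `[a, b]%classic -> fminus u l = a /\ fplus u l = b.
Proof.
by move=> ab; rewrite level_itv; apply: itv_inj => //; exact: fminus_le_fplus.
Qed.

Lemma lr_continuousD (a b : {i01 R} -> R) :
  lr_continuous a -> lr_continuous b -> lr_continuous (fun l => a l + b l).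
Proof.
have H (a' b' : R) e (x y : R) : `|x - a'| < e / 2 -> `|y - b'| < e / 2 ->
    `|x + y - (a' + b')| < e.
  rewrite !ltr_norml => /andP[? ?] /andP[? ?]; apply/andP; split; lra.
move=> [al ar] [bl br]; split=> [l l0 e e0|e e0]; have e20 : 0 < e / 2 by lra.
  have [d d0 dP] := al l l0 _ e20; have [d' d'0 d'P] := bl l l0 _ e20.
  exists (Num.min d d'); first by rewrite lt_min d0.
  move=> m /andP[+ ml]; rewrite ltrBlDr -ltrBlDl lt_min => /andP[h1 h2].
  by apply: H; [apply: dP|apply: d'P]; rewrite ml andbT ltrBlDr -ltrBlDl.
have [d d0 dP] := ar _ e20; have [d' d'0 d'P] := br _ e20.
exists (Num.min d d'); first by rewrite lt_min d0.
move=> m /andP[m0]; rewrite lt_min => /andP[h1 h2].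
by apply: H; [apply: dP|apply: d'P]; rewrite m0.
Qed.

Lemma lr_continuousZ k (a : {i01 R} -> R) :
  lr_continuous a -> lr_continuous (fun l => k * a l).
Proof.
have k1 : 0 < `|k| + 1 by rewrite ltr_wpDl.
have H (x y e : R) : `|x - y| < e / (`|k| + 1) -> `|k * x - k * y| < e.
  rewrite ltr_pdivlMr// -mulrBr normrM mulrC => h.
  by apply: le_lt_trans h; rewrite ler_wpM2r// lerDl.
move=> [al ar]; split=> [l l0 e e0|e e0].
  have [d d0 dP] := al l l0 _ (divr_gt0 e0 k1).
  by exists d => // m /dP/H.
have [d d0 dP] := ar _ (divr_gt0 e0 k1).
by exists d => // m /dP/H.
Qed.

Lemma fuzzy_add_ex u v : exists w, forall l,
  level w l = [set x + y | x in level u l & y in level v l].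
Proof.
have [w wE] := @fuzzy_of_endpoints R
  (fun l => fminus u l + fminus v l) (fun l => fplus u l + fplus v l)
  (fun l => lerD (fminus_le_fplus u l) (fminus_le_fplus v l))
  (fun l m lm => lerD (fminus_homo u lm) (fminus_homo v lm))
  (fun l m lm => lerD (fplus_homo u lm) (fplus_homo v lm))
  (lr_continuousD (fminus_lr u) (fminus_lr v))
  (lr_continuousD (fplus_lr u) (fplus_lr v)).
by exists w => l; rewrite wE !level_itv itv_add//; exact: fminus_le_fplus.
Qed.

Lemma fuzzy_scale_ex k u : exists w, forall l,
  level w l = [set k * x | x in level u l].
Proof.
have [k0|k0] := leP 0 k.
  have [w wE] := @fuzzy_of_endpoints R
    (fun l => k * fminus u l) (fun l => k * fplus u l)
    (fun l => ler_wpM2l k0 (fminus_le_fplus u l))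
    (fun l m lm => ler_wpM2l k0 (fminus_homo u lm))
    (fun l m lm => ler_wpM2l k0 (fplus_homo u lm))
    (lr_continuousZ k (fminus_lr u)) (lr_continuousZ k (fplus_lr u)).
  by exists w => l; rewrite wE level_itv itv_scale_ge0//; exact: fminus_le_fplus.
have k0' := ltW k0.
have [w wE] := @fuzzy_of_endpoints R
  (fun l => k * fplus u l) (fun l => k * fminus u l)
  (fun l => ler_wnM2l k0' (fminus_le_fplus u l))
  (fun l m lm => ler_wnM2l k0' (fplus_homo u lm))
  (fun l m lm => ler_wnM2l k0' (fminus_homo u lm))
  (lr_continuousZ k (fplus_lr u)) (lr_continuousZ k (fminus_lr u)).
by exists w => l; rewrite wE level_itv itv_scale_lt0//; exact: fminus_le_fplus.
Qed.

(* A fuzzy number is determined by its levels, so these are the operations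
   given by interval arithmetic on levels. *)
Definition fuzzy_add u v : fuzzy R := sval (cid (fuzzy_add_ex u v)).
Definition fuzzy_scale k u : fuzzy R := sval (cid (fuzzy_scale_ex k u)).

Lemma fuzzy_level_inj u v : (forall l, level u l = level v l) -> u = v.
Proof.
move=> uv; suff E : fuzzy_fun u = fuzzy_fun v.
  case: u v E {uv} => [u u1 u2 u3 u4 u5] [v v1 v2 v3 v4 v5] /= E; subst v.
  by congr Fuzzy; exact: Prop_irrelevance.
have H u' v' x : (forall l, level u' l = level v' l) ->
    fuzzy_fun u' x <= fuzzy_fun v' x.
  move=> E; have /andP[u0 u1] := fuzzy_range u' x.
  have /andP[v0 v1] := fuzzy_range v' x.
  have [ux|ux] := leP (fuzzy_fun u' x) 0; first exact: le_trans v0.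
  have : level u' (Itv01 u0 u1) x by rewrite level_gt0/=.
  by rewrite E level_gt0.
by apply/funext => x; apply/eqP; rewrite eq_le !H.
Qed.

Lemma level_fuzzy_add u v l :
  level (fuzzy_add u v) l = [set x + y | x in level u l & y in level v l].
Proof. by rewrite /fuzzy_add; case: cid => w /= ->. Qed.

Lemma level_fuzzy_scale k u l :
  level (fuzzy_scale k u) l = [set k * x | x in level u l].
Proof. by rewrite /fuzzy_scale; case: cid => w /= ->. Qed.

Lemma fuzzy_addE u v l :
  fminus (fuzzy_add u v) l = fminus u l + fminus v l /\
  fplus (fuzzy_add u v) l = fplus u l + fplus v l.
Proof.
apply: level_endpoints; first exact: lerD (fminus_le_fplus _ _) (fminus_le_fplus _ _).
by rewrite level_fuzzy_add !level_itv itv_add//; exact: fminus_le_fplus.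
Qed.

Lemma fuzzy_scale_ge0E k u l : 0 <= k ->
  fminus (fuzzy_scale k u) l = k * fminus u l /\
  fplus (fuzzy_scale k u) l = k * fplus u l.
Proof.
move=> k0; apply: level_endpoints; first exact/ler_wpM2l/fminus_le_fplus.
by rewrite level_fuzzy_scale level_itv itv_scale_ge0//; exact: fminus_le_fplus.
Qed.

Lemma fuzzy_scale_lt0E k u l : k < 0 ->
  fminus (fuzzy_scale k u) l = k * fplus u l /\
  fplus (fuzzy_scale k u) l = k * fminus u l.
Proof.
move=> k0; apply: level_endpoints.
  by apply: (ler_wnM2l (ltW k0)); exact: fminus_le_fplus.
by rewrite level_fuzzy_scale level_itv itv_scale_lt0//; exact: fminus_le_fplus.
Qed.

End arithmetic.

Section continuous_fuzzy.
Context {R : realType} {K : topologicalType}.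
Implicit Types f g : continuousType K (fuzzy R).

Lemma continuous_fuzzy_add f g : continuous (fun t => fuzzy_add (f t) (g t)).
Proof.
apply/continuous_fuzzyP => l.
have [f1 f2] := (continuous_fuzzyP f).1 (@cts_fun _ _ f) l.
have [g1 g2] := (continuous_fuzzyP g).1 (@cts_fun _ _ g) l.
split=> t.
  rewrite (_ : (fun _ => _) = fun t => fminus (f t) l + fminus (g t) l).
    exact: cvgD (f1 t) (g1 t).
  by apply/funext => s; rewrite (fuzzy_addE _ _ _).1.
rewrite (_ : (fun _ => _) = fun t => fplus (f t) l + fplus (g t) l).
  exact: cvgD (f2 t) (g2 t).
by apply/funext => s; rewrite (fuzzy_addE _ _ _).2.
Qed.

Lemma continuous_fuzzy_scale (k : R) f :
  continuous (fun t => fuzzy_scale k (f t)).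
Proof.
apply/continuous_fuzzyP => l.
have [f1 f2] := (continuous_fuzzyP f).1 (@cts_fun _ _ f) l.
have H (c d : K -> R) : continuous c -> (forall t, d t = k * c t) ->
    continuous d.
  move=> cc dE t; rewrite (_ : d = fun t => k * c t); last exact/funext.
  by apply: cvgM; [exact: cvg_cst|exact: cc].
have [k0|k0] := leP 0 k; split.
- by apply: H f1 _ => t; rewrite (fuzzy_scale_ge0E _ _ k0).1.
- by apply: H f2 _ => t; rewrite (fuzzy_scale_ge0E _ _ k0).2.
- by apply: H f2 _ => t; rewrite (fuzzy_scale_lt0E _ _ k0).1.
- by apply: H f1 _ => t; rewrite (fuzzy_scale_lt0E _ _ k0).2.
Qed.

Definition cfuzzy_add f g : continuousType K (fuzzy R) :=
  mkcts (@continuous_fuzzy_add f g).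

Definition cfuzzy_scale (k : R) f : continuousType K (fuzzy R) :=
  mkcts (@continuous_fuzzy_scale k f).

Definition cfuzzy_dist f g : R :=
  sup [set sup [set Num.max `|fminus (f t) l - fminus (g t) l|
                            `|fplus (f t) l - fplus (g t) l|
               | l in [set: {i01 R}]]
      | t in [set: K]].

(* The suprema in [cfuzzy_dist] are those of bounded sets. *)
Lemma cfuzzy_dist_ge (cK : compact [set: K]) f g t l :
  Num.max `|fminus (f t) l - fminus (g t) l|
          `|fplus (f t) l - fplus (g t) l| <= cfuzzy_dist f g.
Proof.
have bnd (h : continuousType K (fuzzy R)) : exists M, forall s m,
    `|fminus (h s) m| <= M /\ `|fplus (h s) m| <= M.
  have [h1 h2] := (continuous_fuzzyP h).1 (@cts_fun _ _ h) (zero01 R).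
  have := (compact_near_coveringP _).1 cK R (pinfty_nbhs R)
    (fun M s => `|fminus (h s) (zero01 R)| <= M /\
                `|fplus (h s) (zero01 R)| <= M) _.
  case=> [t0 _|M [Mr MP]].
    pose M0 := Num.max (`|fminus (h t0) (zero01 R)| + 1)
                       (`|fplus (h t0) (zero01 R)| + 1).
    have /cvgrPdist_lt/(_ 1 ltr01) n1 := h1 t0.
    have /cvgrPdist_lt/(_ 1 ltr01) n2 := h2 t0.
    near=> s M => /=.
    have : M0 <= M by near: M; exact: nbhs_pinfty_ge (num_real _).
    rewrite /M0 ge_max => /andP[M1 M2].
    have s1 : `|fminus (h t0) (zero01 R) - fminus (h s) (zero01 R)| < 1 by near: s.
    have s2 : `|fplus (h t0) (zero01 R) - fplus (h s) (zero01 R)| < 1 by near: s.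
    have := lerB_dist (fminus (h s) (zero01 R)) (fminus (h t0) (zero01 R)).
    have := lerB_dist (fplus (h s) (zero01 R)) (fplus (h t0) (zero01 R)).
    by rewrite distrC => ?; rewrite distrC => ?; split; lra.
  exists (M + 1) => s m.
  have [] := MP (M + 1) _ s I; first by rewrite ltrDl.
  rewrite !ler_norml => /andP[? ?] /andP[? ?].
  have m0 : (zero01 R <= m)%O by exact: i01_ge0.
  have := fminus_homo (h s) m0; have := fplus_homo (h s) m0.
  have := fminus_le_fplus (h s) m => ? ? ?.
  by split; apply/andP; split; lra.
have [M fM] := bnd f; have [N gN] := bnd g.
have MN s m : Num.max `|fminus (f s) m - fminus (g s) m|
                      `|fplus (f s) m - fplus (g s) m| <= M + N.
  have [? ?] := fM s m; have [? ?] := gN s m.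
  by rewrite ge_max; apply/andP; split; apply: le_trans (ler_normB _ _) _;
    exact: lerD.
have ub1 s : has_ubound [set Num.max `|fminus (f s) m - fminus (g s) m|
    `|fplus (f s) m - fplus (g s) m| | m in [set: {i01 R}]].
  by exists (M + N) => _ [m _ <-]; exact: MN.
apply: (@le_trans _ _ (sup [set Num.max `|fminus (f t) m - fminus (g t) m|
    `|fplus (f t) m - fplus (g t) m| | m in [set: {i01 R}]])).
  by apply: ub_le_sup; [exact: ub1|exists l].
apply: ub_le_sup; last by exists t.
exists (M + N) => _ [s _ <-]; apply: ge_sup; last by move=> _ [m _ <-]; exact: MN.
by eexists; exists (zero01 R).
Unshelve. all: by end_near. Qed.

End continuous_fuzzy.

Section Cbar_properties.
Context {R : realType} {K : topologicalType}.
Implicit Type f : {i01 R} * K -> R.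

(* The one-sided neighbourhoods below are punctured: they do not contain the
   base level itself. *)
Definition jointly_left_continuous f :=
  forall (l0 : {i01 R}) (t0 : K), 0 < l0%:num -> forall e, 0 < e ->
  exists2 d, 0 < d & exists2 V, open_nbhs t0 V &
    forall (a : {i01 R}) s, l0%:num - d < a%:num < l0%:num -> V s ->
      `|f (a, s) - f (l0, t0)| < e.

Definition jointly_right_continuous f :=
  forall t0 : K, forall e, 0 < e ->
  exists2 d, 0 < d & exists2 V, open_nbhs t0 V &
    forall (a : {i01 R}) s, 0 < a%:num < d -> V s ->
      `|f (a, s) - f (zero01 R, t0)| < e.

Definition monotone_levels f := forall t,
  (forall l m : {i01 R}, l%:num <= m%:num -> f (l, t) <= f (m, t)) \/
  (forall l m : {i01 R}, l%:num <= m%:num -> f (m, t) <= f (l, t)).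

End Cbar_properties.

(* The compactness of K, carried as a parameter of the type, is what makes the
   sup-distance below a metric. *)
Record Cbar (R : realType) (K : topologicalType) (cK : compact [set: K]) := {
  Cbar_fun :> {i01 R} * K -> R ;
  Cbar_left : jointly_left_continuous Cbar_fun ;
  Cbar_right : jointly_right_continuous Cbar_fun ;
  Cbar_monotone : monotone_levels Cbar_fun }.

HB.instance Definition _ (R : realType) (K : topologicalType)
  (cK : compact [set: K]) := gen_eqMixin (Cbar R cK).
HB.instance Definition _ (R : realType) (K : topologicalType)
  (cK : compact [set: K]) := gen_choiceMixin (Cbar R cK).

Definition sup_norm (R : realType) (T : Type) (f : T -> R) : R :=
  sup [set `|f x| | x in [set: T]].

Section Cbar_metric.
Context {R : realType} {K : topologicalType} {cK : compact [set: K]}.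
Implicit Types f g h : Cbar R cK.

Let one01 : {i01 R} := 1%:i01.

Let near_bound_left f t0 : \forall s \near t0,
  `|f (one01, s)| <= `|f (one01, t0)| + 2.
Proof.
have [d d0 [V [oV Vt] dV]] := @Cbar_left _ _ _ f one01 t0 ltr01 1 ltr01.
apply: (@filterS _ _ _ V); last exact: open_nbhs_nbhs.
move=> s Vs.
have [d' d'0 [W [oW Ws] dW]] := @Cbar_left _ _ _ f one01 s ltr01 1 ltr01.
pose c := Num.min 1 (Num.min d d') / 2.
have c0 : 0 < Num.min 1 (Num.min d d') by rewrite !lt_min ltr01 d0.
have : Num.min 1 (Num.min d d') <= 1 by rewrite ge_min lexx.
have : Num.min 1 (Num.min d d') <= d by rewrite !ge_min lexx orbT.
have : Num.min 1 (Num.min d d') <= d' by rewrite !ge_min lexx !orbT.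
move=> cd' cd c1.
have m0 : 0 <= 1 - c by rewrite /c; lra.
have m1 : 1 - c <= 1 by rewrite /c; lra.
have := dV (Itv01 m0 m1) s; have := dW (Itv01 m0 m1) s => /=.
move=> /(_ _ Ws) + /(_ _ Vs).
have -> : 1 - d' < 1 - c < 1 by rewrite /c; apply/andP; split; lra.
have -> : 1 - d < 1 - c < 1 by rewrite /c; apply/andP; split; lra.
move=> /(_ isT) h1 /(_ isT) h2.
have -> : f (one01, s) = f (one01, t0) + (f (Itv01 m0 m1, s) - f (one01, t0))
  - (f (Itv01 m0 m1, s) - f (one01, s)) by ring.
apply: le_trans (ler_normB _ _) _; move: (ler_normD (f (one01, t0))
  (f (Itv01 m0 m1, s) - f (one01, t0))); lra.
Qed.

Let near_bound_right f t0 : \forall s \near t0,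
  `|f (zero01 R, s)| <= `|f (zero01 R, t0)| + 2.
Proof.
have [d d0 [V [oV Vt] dV]] := @Cbar_right _ _ _ f t0 1 ltr01.
apply: (@filterS _ _ _ V); last exact: open_nbhs_nbhs.
move=> s Vs.
have [d' d'0 [W [oW Ws] dW]] := @Cbar_right _ _ _ f s 1 ltr01.
pose c := Num.min 1 (Num.min d d') / 2.
have c0 : 0 < Num.min 1 (Num.min d d') by rewrite !lt_min ltr01 d0.
have : Num.min 1 (Num.min d d') <= 1 by rewrite ge_min lexx.
have : Num.min 1 (Num.min d d') <= d by rewrite !ge_min lexx orbT.
have : Num.min 1 (Num.min d d') <= d' by rewrite !ge_min lexx !orbT.
move=> cd' cd c1.
have m0 : 0 <= c by rewrite /c; lra.
have m1 : c <= 1 by rewrite /c; lra.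
have := dV (Itv01 m0 m1) s; have := dW (Itv01 m0 m1) s => /=.
move=> /(_ _ Ws) + /(_ _ Vs).
have -> : 0 < c < d' by rewrite /c; apply/andP; split; lra.
have -> : 0 < c < d by rewrite /c; apply/andP; split; lra.
move=> /(_ isT) h1 /(_ isT) h2.
have -> : f (zero01 R, s) = f (zero01 R, t0) +
  (f (Itv01 m0 m1, s) - f (zero01 R, t0))
  - (f (Itv01 m0 m1, s) - f (zero01 R, s)) by ring.
apply: le_trans (ler_normB _ _) _; move: (ler_normD (f (zero01 R, t0))
  (f (Itv01 m0 m1, s) - f (zero01 R, t0))); lra.
Qed.

Lemma Cbar_bounded f : exists M, forall x, `|f x| <= M.
Proof.
have := (compact_near_coveringP _).1 cK R (pinfty_nbhs R)
  (fun M s => forall l, `|f (l, s)| <= M) _.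
case=> [t0 _|M [Mr MP]]; last first.
  by exists (M + 1) => -[l s]; apply: (MP (M + 1)) => //; rewrite ltrDl.
pose M0 := Num.max (`|f (one01, t0)| + 2) (`|f (zero01 R, t0)| + 2).
have H1 := near_bound_left f t0; have H2 := near_bound_right f t0.
near=> s M => /= l.
have : M0 <= M by near: M; exact: nbhs_pinfty_ge (num_real _).
rewrite /M0 ge_max => /andP[M1 M2].
have s1 : `|f (one01, s)| <= `|f (one01, t0)| + 2 by near: s.
have s2 : `|f (zero01 R, s)| <= `|f (zero01 R, t0)| + 2 by near: s.
have b1 := le_trans s1 M1; have b2 := le_trans s2 M2.
move: b1 b2; rewrite !ler_norml => /andP[? ?] /andP[? ?].
have [h|h] := @Cbar_monotone _ _ _ f s.
  have := h (zero01 R) l (i01_ge0 l); have := h l one01 (i01_le1 l).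
  by move=> ? ?; apply/andP; split; lra.
have := h (zero01 R) l (i01_ge0 l); have := h l one01 (i01_le1 l).
by move=> ? ?; apply/andP; split; lra.
Unshelve. all: by end_near. Qed.

Definition Cbar_dist f g : R := sup_norm (fun x => f x - g x).

Let dist_ub f g : has_ubound [set `|f x - g x| | x in [set: {i01 R} * K]].
Proof.
have [M fM] := Cbar_bounded f; have [N gN] := Cbar_bounded g.
exists (M + N) => _ [x _ <-]; apply: le_trans (ler_normB _ _) _.
exact: lerD.
Qed.

Lemma Cbar_dist_ge f g x : `|f x - g x| <= Cbar_dist f g.
Proof. by apply: ub_le_sup; [exact: dist_ub|exists x]. Qed.

Lemma Cbar_dist_le f g (M : R) : 0 <= M ->
  (forall x, `|f x - g x| <= M) -> Cbar_dist f g <= M.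
Proof.
move=> M0 h; rewrite /Cbar_dist /sup_norm; set S := (X in sup X).
have [->|/set0P S0] := eqVneq S set0; first by rewrite sup0.
by apply: ge_sup => // _ [x _ <-].
Qed.

Lemma Cbar_dist_ge0 f g : 0 <= Cbar_dist f g.
Proof.
rewrite /Cbar_dist /sup_norm; set S := (X in sup X).
have [->|/set0P [_ [x _ _]]] := eqVneq S set0; first by rewrite sup0.
exact: le_trans (Cbar_dist_ge f g x).
Qed.

Lemma Cbar_distxx f : Cbar_dist f f = 0.
Proof.
apply/eqP; rewrite eq_le Cbar_dist_ge0 andbT; apply: Cbar_dist_le => // x.
by rewrite subrr normr0.
Qed.

Lemma Cbar_dist_eq0 f g : Cbar_dist f g = 0 -> f = g.
Proof.
move=> fg; have E : Cbar_fun f = Cbar_fun g.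
  apply/funext => x; apply/eqP; rewrite -subr_eq0 -normr_le0 -fg.
  exact: Cbar_dist_ge.
case: f g E {fg} => [f f1 f2 f3] [g g1 g2 g3] /= E; subst g.
by congr Build_Cbar; exact: Prop_irrelevance.
Qed.

Lemma Cbar_distC f g : Cbar_dist f g = Cbar_dist g f.
Proof.
rewrite /Cbar_dist /sup_norm; congr sup; apply/seteqP.
by split=> _ [x _ <-]; exists x => //; rewrite distrC.
Qed.

Lemma Cbar_dist_triangle g f h :
  Cbar_dist f h <= Cbar_dist f g + Cbar_dist g h.
Proof.
apply: Cbar_dist_le => [|x]; first by rewrite addr_ge0 ?Cbar_dist_ge0.
rewrite -(subrK (g x) (f x)) -addrA (le_trans (ler_normD _ _))//.
by apply: lerD; exact: Cbar_dist_ge.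
Qed.

HB.instance Definition _ := isMetric.Build R (Cbar R cK)
  Cbar_distxx Cbar_dist_eq0 Cbar_distC Cbar_dist_triangle.

Definition Dinf (p q : Cbar R cK * Cbar R cK) : R :=
  Num.max (sup_norm (fun x => p.1 x - q.1 x)) (sup_norm (fun x => p.2 x - q.2 x)).

Let Dinf_ge0 p q : 0 <= Dinf p q.
Proof. by rewrite le_max Cbar_dist_ge0. Qed.

Let Dinf_eq0 p q : Dinf p q = 0 -> p = q.
Proof.
move=> pq; have : Dinf p q <= 0 by rewrite pq.
rewrite ge_max => /andP[h1 h2]; case: p q h1 h2 {pq} => [p1 p2] [q1 q2] /= h1 h2.
by congr (_, _); apply: Cbar_dist_eq0; apply/eqP; rewrite eq_le Cbar_dist_ge0 andbT.
Qed.

Let ball_Dinf (p : Cbar R cK * Cbar R cK) d : ball p d = [set q | Dinf p q < d].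
Proof.
apply/seteqP; split=> q.
  by move=> [] /=; rewrite !ballEmdist /Dinf gt_max => h1 h2; apply/andP.
by rewrite /= gt_max => /andP[h1 h2]; split; rewrite ballEmdist.
Qed.

(* Makes [Dinf] the distance [mdist] of the product; in particular [closed] on
   pairs refers to the topology of [Dinf]. *)
HB.instance Definition _ := PseudoMetric_isMetric.Build R
  (Cbar R cK * Cbar R cK)%type Dinf_ge0 Dinf_eq0 ball_Dinf.

End Cbar_metric.

Definition fun_pair (R : realType) (T : Type) : Type := ((T -> R) * (T -> R))%type.

Definition lincomb (R : realType) (T : Type) (mu : R) (p : fun_pair R T)
    (eta : R) (q : fun_pair R T) : fun_pair R T :=
  (fun x => mu * p.1 x + eta * q.1 x, fun x => mu * p.2 x + eta * q.2 x).

Definition convex_cone (R : realType) (T : Type) (S : set (fun_pair R T)) :=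
  forall p q mu eta, S p -> S q -> 0 <= mu -> 0 <= eta -> S (lincomb mu p eta q).

Definition Cbar_pair (R : realType) (K : topologicalType)
    (cK : compact [set: K]) (p : Cbar R cK * Cbar R cK) :
    fun_pair R ({i01 R} * K) :=
  (p.1 : {i01 R} * K -> R, p.2 : {i01 R} * K -> R).

(* Main.v *)
Require Import Defs.
From mathcomp Require Import all_boot all_order all_algebra.
From mathcomp Require Import all_classical all_reals all_analysis.
From mathcomp Require Import lra.

Import Order.TTheory GRing.Theory Num.Theory.
Import numFieldNormedType.Exports.
Local Open Scope classical_set_scope.
Local Open Scope ring_scope.

(** The embedding sends [f] to its two endpoint functions
    [(l, t) |-> fminus (f t) l] and [(l, t) |-> fplus (f t) l].

    Level convergence only gives continuity in [t] for each fixed level, and the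
    theory of a single fuzzy number only gives one-sided continuity in [l] for
    each fixed [t].  Joint continuity follows from monotonicity in [l]: on a
    band of levels between [l] and [m] the values at a point [s] are trapped
    between those at the two edges of the band, and these are controlled
    uniformly for [s] close to [t] by continuity at just two levels
    ([monotone_band]).

    The endpoint functions determine the levels, hence [f], so the embedding is
    injective.  Addition and multiplication by nonnegative scalars act on
    endpoints coordinatewise, and both distances are suprema of the same
    numbers, taken in a different order.

    For the image, the Goetschel-Voxman construction turns any pair of one-sided
    continuous endpoint functions into a fuzzy number as soon as the lower one
    increases, the upper one decreases and they are ordered.  Consequently the
    image consists exactly of the pairs in [Cbar] with these three properties
    that are moreover continuous in [t] at each level ([range_endpoints]), the
    one-sided continuity in [l] being part of membership in [Cbar].  All of these
    conditions pass to uniform limits, so the image is closed; it is a convex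
    cone because the embedding preserves nonnegative combinations. *)

(** * Joint one-sided continuity from separate continuity *)

Section joint_continuity.
Context {R : realType} {K : topologicalType} (f : {i01 R} * K -> R).
Hypothesis f_mono : monotone_levels f.
Hypothesis f_cont : forall l, continuous (fun t => f (l, t)).
Hypothesis f_lr : forall t, lr_continuous (fun l => f (l, t)).

(** By monotonicity, closeness to [c] at the two edges of a band of levels gives
    closeness on the whole band, and being close at an edge is an open condition
    on [t].  The direction of monotonicity may vary with [s]. *)
Lemma monotone_band (l m : {i01 R}) (t : K) (c e : R) :
  `|f (l, t) - c| < e -> `|f (m, t) - c| < e ->
  exists2 V, open_nbhs t V & forall (k : {i01 R}) s,
    l%:num <= k%:num <= m%:num -> V s -> `|f (k, s) - c| < e.
Proof.
move=> le me.
have edge k : `|f (k, t) - c| < e -> \forall s \near t, `|f (k, s) - c| < e.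
  move=> ke; have cont : (fun s => `|f (k, s) - c|) @ t --> `|f (k, t) - c|.
    by apply: cvg_norm; apply: cvgB; [exact: f_cont|exact: cvg_cst].
  exact: (cvgr_lt _ cont _ ke).
have : nbhs t [set s | `|f (l, s) - c| < e /\ `|f (m, s) - c| < e].
  by apply: filterI; exact: edge.
rewrite nbhsE => -[V tV Vlm]; exists V => // k s /andP[lk km] /Vlm[].
rewrite /= !ltr_norml => /andP[? ?] /andP[? ?].
have [h|h] := f_mono s.
  by have := h _ _ lk; have := h _ _ km => ? ?; apply/andP; split; lra.
by have := h _ _ lk; have := h _ _ km => ? ?; apply/andP; split; lra.
Qed.

Lemma jointly_left_continuous_of_separate : jointly_left_continuous f.
Proof.
move=> l t l0 e e0; have [d d0 dP] := (f_lr t).1 _ l0 _ e0.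
(* A level strictly below [l], nonnegative and within [d] of [l]. *)
pose m := Num.max (l%:num - d / 2) (l%:num / 2).
have m1 : l%:num - d / 2 <= m by rewrite le_max lexx.
have m2 : l%:num / 2 <= m by rewrite le_max lexx orbT.
have ml : m < l%:num by rewrite gt_max; apply/andP; split; lra.
have l1 := i01_le1 l.
have m01 : 0 <= m by lra.
have m11 : m <= 1 by lra.
have me : `|f (Itv01 m01 m11, t) - f (l, t)| < e.
  by apply: dP => /=; apply/andP; split; lra.
have le : `|f (l, t) - f (l, t)| < e by rewrite subrr normr0.
have [V tV VP] := monotone_band _ _ _ _ _ me le.
exists (l%:num - m); first by rewrite subr_gt0.
by exists V => // a s /andP[ma al]; apply: VP => /=; apply/andP; split; lra.
Qed.

Lemma jointly_right_continuous_of_separate : jointly_right_continuous f.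
Proof.
move=> t e e0; have [d d0 dP] := (f_lr t).2 _ e0.
pose m := Num.min (d / 2) 1.
have m1 : m <= d / 2 by rewrite ge_min lexx.
have m11 : m <= 1 by rewrite ge_min lexx orbT.
have m0 : 0 < m by rewrite lt_min ltr01 andbT; lra.
have me : `|f (Itv01 (ltW m0) m11, t) - f (zero01 R, t)| < e.
  by apply: dP => /=; apply/andP; split; lra.
have ze : `|f (zero01 R, t) - f (zero01 R, t)| < e by rewrite subrr normr0.
have [V tV VP] := monotone_band _ _ _ _ _ ze me.
exists m => //; exists V => // a s /andP[a0 am].
by apply: VP => /=; apply/andP; split; lra.
Qed.

Lemma Cbar_of_separate (cK : compact [set: K]) :
  exists h : Cbar R cK, Cbar_fun h = f.
Proof.
by exists (@Build_Cbar R K cK f jointly_left_continuous_of_separate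
  jointly_right_continuous_of_separate f_mono).
Qed.

End joint_continuity.

Lemma Cbar_lr_continuous {R : realType} {K : topologicalType}
    {cK : compact [set: K]} (h : Cbar R cK) (t : K) :
  lr_continuous (fun l => h (l, t)).
Proof.
split=> [l l0 e e0|e e0].
  have [d d0 [V [_ Vt] VP]] := @Cbar_left _ _ _ h l t l0 e e0.
  by exists d => // m lm; exact: VP.
have [d d0 [V [_ Vt] VP]] := @Cbar_right _ _ _ h t e e0.
by exists d => // m lm; exact: VP.
Qed.

(** * The endpoint map *)

Section endpoints.
Context {R : realType} {K : topologicalType} {cK : compact [set: K]}.
Implicit Types (f g : continuousType K (fuzzy R)) (p q : Cbar R cK * Cbar R cK).

Lemma fminus_Cbar f :
  exists h : Cbar R cK, Cbar_fun h = fun x => fminus (f x.2) x.1.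
Proof.
apply: Cbar_of_separate => [t|l|t].
- by left => l m; exact: fminus_homo.
- exact: ((continuous_fuzzyP f).1 (@cts_fun _ _ f) l).1.
- exact: (@fminus_lr R (f t)).
Qed.

Lemma fplus_Cbar f :
  exists h : Cbar R cK, Cbar_fun h = fun x => fplus (f x.2) x.1.
Proof.
apply: Cbar_of_separate => [t|l|t].
- by right => l m; exact: fplus_homo.
- exact: ((continuous_fuzzyP f).1 (@cts_fun _ _ f) l).2.
- exact: (@fplus_lr R (f t)).
Qed.

Definition endpoints f : Cbar R cK * Cbar R cK :=
  (sval (cid (fminus_Cbar f)), sval (cid (fplus_Cbar f))).

Lemma endpoints1E f x : (endpoints f).1 x = fminus (f x.2) x.1.
Proof. by rewrite /endpoints /=; case: cid => h /= ->. Qed.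

Lemma endpoints2E f x : (endpoints f).2 x = fplus (f x.2) x.1.
Proof. by rewrite /endpoints /=; case: cid => h /= ->. Qed.

Lemma endpoints_inj : injective endpoints.
Proof.
move=> f g fg; apply/continuousEP => t; apply: fuzzy_level_inj => l.
rewrite !level_itv; congr (`[_, _]%classic).
  by rewrite -(endpoints1E f (l, t)) fg endpoints1E.
by rewrite -(endpoints2E f (l, t)) fg endpoints2E.
Qed.

Lemma endpoints_lincomb f g (mu eta : R) : 0 <= mu -> 0 <= eta ->
  Cbar_pair (endpoints (cfuzzy_add (cfuzzy_scale mu f) (cfuzzy_scale eta g))) =
  lincomb mu (Cbar_pair (endpoints f)) eta (Cbar_pair (endpoints g)).
Proof.
move=> mu0 eta0; rewrite /Cbar_pair /lincomb; congr (_, _); apply/funext => x /=.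
  by rewrite !endpoints1E (fuzzy_addE _ _ _).1 !(fuzzy_scale_ge0E _ _ _).1.
by rewrite !endpoints2E (fuzzy_addE _ _ _).2 !(fuzzy_scale_ge0E _ _ _).2.
Qed.

Lemma cfuzzy_dist_ge0 f g : 0 <= cfuzzy_dist f g.
Proof.
have [[t]|K0] := pselect (inhabited K).
  apply: le_trans (cfuzzy_dist_ge cK f g t (zero01 R)).
  by rewrite le_max normr_ge0.
(* On an empty [K] the distance is the supremum of the empty set. *)
rewrite /cfuzzy_dist; set S := (X in sup X); suff -> : S = set0 by rewrite sup0.
by apply/seteqP; split=> // x [t _ _]; case: K0.
Qed.

Lemma endpoints_isometry f g : Dinf (endpoints f) (endpoints g) = cfuzzy_dist f g.
Proof.
apply/eqP; rewrite eq_le; apply/andP; split.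
  rewrite /Dinf ge_max; apply/andP; split;
    apply: Cbar_dist_le (cfuzzy_dist_ge0 f g) _ => -[l t].
    rewrite !endpoints1E; apply: le_trans (cfuzzy_dist_ge cK f g t l).
    by rewrite le_max lexx.
  rewrite !endpoints2E; apply: le_trans (cfuzzy_dist_ge cK f g t l).
  by rewrite le_max lexx orbT.
have D0 : 0 <= Dinf (endpoints f) (endpoints g).
  by rewrite /Dinf le_max Cbar_dist_ge0.
rewrite /cfuzzy_dist; set S := (X in sup X).
have [->|/set0P S0] := eqVneq S set0; first by rewrite sup0.
apply: ge_sup => // _ [t _ <-]; apply: ge_sup.
  by eexists; exists (zero01 R).
move=> _ [l _ <-]; rewrite /Dinf ge_max; apply/andP; split.
  have := Cbar_dist_ge (endpoints f).1 (endpoints g).1 (l, t).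
  by rewrite !endpoints1E le_max => ->.
have := Cbar_dist_ge (endpoints f).2 (endpoints g).2 (l, t).
by rewrite !endpoints2E le_max => ->; rewrite orbT.
Qed.

(** * The image of the endpoint map *)

(** Continuity in [l] is not listed since every element of [Cbar] has it. *)
Definition endpoint_like p :=
  [/\ forall t (l m : {i01 R}), (l <= m)%O -> p.1 (l, t) <= p.1 (m, t),
      forall t (l m : {i01 R}), (l <= m)%O -> p.2 (m, t) <= p.2 (l, t),
      forall x, p.1 x <= p.2 x,
      forall l, continuous (fun t => p.1 (l, t)) &
      forall l, continuous (fun t => p.2 (l, t))].

(** The one-sided continuity that membership in [Cbar] provides at each [t] is what
    the Goetschel-Voxman construction asks for, so it can be applied pointwise in
    [t]; continuity at each level is then continuity for level convergence. *)
Lemma range_endpoints : range endpoints = [set p | endpoint_like p].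
Proof.
apply/seteqP; split=> [_ [f _ <-]|[p q] [/= p_homo q_homo pq p_cont q_cont]].
  split=> [t l m lm|t l m lm|x|l|l].
  - by rewrite !endpoints1E; exact: fminus_homo.
  - by rewrite !endpoints2E; exact: fplus_homo.
  - by rewrite endpoints1E endpoints2E; exact: fminus_le_fplus.
  - rewrite (_ : (fun t => _) = fun t => fminus (f t) l).
      exact: ((continuous_fuzzyP f).1 (@cts_fun _ _ f) l).1.
    by apply/funext => t; rewrite endpoints1E.
  - rewrite (_ : (fun t => _) = fun t => fplus (f t) l).
      exact: ((continuous_fuzzyP f).1 (@cts_fun _ _ f) l).2.
    by apply/funext => t; rewrite endpoints2E.
have /choice[f fE] t : exists u : fuzzy R, forall l,
    fminus u l = p (l, t) /\ fplus u l = q (l, t).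
  have [u uE] := fuzzy_of_endpoints (fun l => pq (l, t)) (p_homo t) (q_homo t)
    (Cbar_lr_continuous p t) (Cbar_lr_continuous q t).
  by exists u => l; apply: level_endpoints.
have f_cont : continuous f.
  apply/continuous_fuzzyP => l; split.
    by rewrite (_ : (fun t => _) = fun t => p (l, t)) //;
      apply/funext => t; rewrite (fE t l).1.
  by rewrite (_ : (fun t => _) = fun t => q (l, t)) //;
    apply/funext => t; rewrite (fE t l).2.
exists (mkcts f_cont) => //.
rewrite [LHS]surjective_pairing; congr (_, _);
  apply: Cbar_dist_eq0; apply/eqP; rewrite eq_le Cbar_dist_ge0 andbT;
  apply: Cbar_dist_le => // -[l t].
  by rewrite endpoints1E (fE t l).1 subrr normr0.
by rewrite endpoints2E (fE t l).2 subrr normr0.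
Qed.

Lemma closure_Cbar_pair (S : set (Cbar R cK * Cbar R cK)) p e :
  closure S p -> 0 < e ->
  exists2 q, S q & forall x, `|p.1 x - q.1 x| < e /\ `|p.2 x - q.2 x| < e.
Proof.
move=> /(_ (ball p e)) + e0 => /(_ (nbhsx_ballx _ _ e0))[q [Sq]].
move=> [] /=; rewrite !ballEmdist /= => d1 d2; exists q => // x.
by split; [apply: le_lt_trans d1|apply: le_lt_trans d2]; exact: Cbar_dist_ge.
Qed.

(** The approximation error is the same at every point, so the continuity of the
    approximants carries over. *)
Lemma continuous_approx (T : topologicalType) (a : T -> R) :
  (forall e, 0 < e -> exists2 b : T -> R,
    continuous b & forall t, `|a t - b t| < e) -> continuous a.
Proof.
move=> ab t; apply/cvgrPdist_lt => e e0.
have e3 : 0 < e / 3 by lra.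
have [b b_cont abe] := ab _ e3.
have /cvgrPdist_lt/(_ _ e3) := b_cont t; apply: filterS => s.
have := abe t; have := abe s; rewrite !ltr_norml.
by move=> /andP[? ?] /andP[? ?] /andP[? ?]; apply/andP; split; lra.
Qed.

(** Each condition compares finitely many values of [p] or is continuity in [t], and
    a distance in [Dinf] bounds the error uniformly in [l] and [t]. *)
Lemma closed_endpoint_like : closed [set p | endpoint_like p].
Proof.
move=> p clp.
have approx e : 0 < e -> exists2 q, endpoint_like q &
    forall x, (q.1 x - e < p.1 x < q.1 x + e) /\ (q.2 x - e < p.2 x < q.2 x + e).
  move=> e0; have [q qE pq] := closure_Cbar_pair _ _ _ clp e0.
  by exists q => // x; have [] := pq x; rewrite !ltr_distl.
split=> [t l m lm|t l m lm|x|l|l].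
- apply/ler_addgt0Pr => e e0; have e2 : 0 < e / 2 by lra.
  have [q [+ _ _ _ _] pq] := approx _ e2 => /(_ t l m lm) h.
  have [/andP[? ?] _] := pq (l, t); have [/andP[? ?] _] := pq (m, t); lra.
- apply/ler_addgt0Pr => e e0; have e2 : 0 < e / 2 by lra.
  have [q [_ + _ _ _] pq] := approx _ e2 => /(_ t l m lm) h.
  have [_ /andP[? ?]] := pq (l, t); have [_ /andP[? ?]] := pq (m, t); lra.
- apply/ler_addgt0Pr => e e0; have e2 : 0 < e / 2 by lra.
  have [q [_ _ /(_ x) h _ _] pq] := approx _ e2.
  have [/andP[? ?] /andP[? ?]] := pq x; lra.
- apply: continuous_approx => e e0; have [q [_ _ _ h _] pq] := approx _ e0.
  by exists (fun t => q.1 (l, t)) => // t; rewrite ltr_distl (pq _).1.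
- apply: continuous_approx => e e0; have [q [_ _ _ _ h] pq] := approx _ e0.
  by exists (fun t => q.2 (l, t)) => // t; rewrite ltr_distl (pq _).2.
Qed.

End endpoints.

Theorem theorem4p7 (R : realType) (K : topologicalType)
    (cK : compact [set: K]) (hK : hausdorff_space K) :
  exists Phi : continuousType K (fuzzy R) -> Cbar R cK * Cbar R cK,
  [/\ injective Phi,
      forall (f g : continuousType K (fuzzy R)) (mu eta : R),
        0 <= mu -> 0 <= eta ->
        Cbar_pair (Phi (cfuzzy_add (cfuzzy_scale mu f) (cfuzzy_scale eta g))) =
        lincomb mu (Cbar_pair (Phi f)) eta (Cbar_pair (Phi g)),
      forall f g : continuousType K (fuzzy R),
        Dinf (Phi f) (Phi g) = cfuzzy_dist f g,
      closed (range Phi) &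
      convex_cone (@Cbar_pair R K cK @` range Phi)].
Proof.
exists endpoints; split.
- exact: endpoints_inj.
- exact: endpoints_lincomb.
- exact: endpoints_isometry.
- by rewrite range_endpoints; exact: closed_endpoint_like.
- move=> _ _ mu eta [_ [f _ <-] <-] [_ [g _ <-] <-] mu0 eta0.
  by rewrite -endpoints_lincomb//; eexists; [eexists|].
Qed.
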